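(* Let $d_x,d_r\ge 1$ be integers, let $\mathbf{A}\in\mathbb{R}^{d_r\times d_r}$, $\mathbf{W}^{in}\in\mathbb{R}^{d_r\times d_x}$ and $\mathbf{W}^{out}\in\mathbb{R}^{d_x\times d_r}$ be matrices, and let $\mathbf{x}_1,\mathbf{x}_2,\ldots\in\mathbb{R}^{d_x}$ be a sequence of vectors. Consider the reservoir computer with identity activation function and linear read-out: $\mathbf{r}_1=0\in\mathbb{R}^{d_r}$ and, for $i\ge 1$, $$\mathbf{r}_{i+1}=\mathbf{A}\mathbf{r}_i+\mathbf{W}^{in}\mathbf{x}_i,\qquad \mathbf{y}_{i+1}=\mathbf{W}^{out}\mathbf{r}_{i+1}.$$ Then the output is a vector autoregression in the inputs: for every $\ell\ge 1$, $$\mathbf{y}_{\ell+1}=a_\ell\mathbf{x}_1+a_{\ell-1}\mathbf{x}_2+\cdots+a_2\mathbf{x}_{\ell-1}+a_1\mathbf{x}_\ell,$$ where the $d_x\times d_x$ coefficient matrices are $$a_j=\mathbf{W}^{out}\mathbf{A}^{j-1}\mathbf{W}^{in},\qquad j=1,2,\ldots,\ell.$$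
   Context: Convention: $\mathbf{A}^0=I$ is the identity matrix. A reservoir computer (RC) with activation $q$ is the recursion $\mathbf{r}_{i+1}=(1-\alpha)\mathbf{r}_i+\alpha\, q(\mathbf{A}\mathbf{r}_i+\mathbf{W}^{in}\mathbf{x}_i+\mathbf{b})$, with $q$ applied componentwise, and read-out $\mathbf{y}_{i+1}=\mathbf{W}^{out}\mathbf{r}_{i+1}$; here $\alpha=1$, $\mathbf{b}=0$ and $q(s)=s$. *)

(* Defs.v *)
From mathcomp Require Import all_boot all_order all_algebra.
From mathcomp Require Import reals.

Set Implicit Arguments.
Unset Strict Implicit.
Unset Printing Implicit Defensive.

Import GRing.Theory.
Local Open Scope ring_scope.

(* The coefficient a_j, meaningful for j >= 1 only. Here [A ^+ 0] is the
   identity matrix. *)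
Definition var_coef (R : realType) (dx dr : nat) (A : 'M[R]_dr)
    (Win : 'M[R]_(dr, dx)) (Wout : 'M[R]_(dx, dr)) (j : nat) : 'M[R]_dx :=
  Wout *m A ^+ (j - 1) *m Win.

(* Main.v *)
Require Import Defs.
From mathcomp Require Import all_boot all_order all_algebra.
From mathcomp Require Import reals.

Set Implicit Arguments.
Unset Strict Implicit.
Unset Printing Implicit Defensive.

Import GRing.Theory.
Local Open Scope ring_scope.

(** The state starts at zero and evolves linearly, so inputs superpose: [x k] enters [r k.+1]
    through [Win] and is multiplied by [A] once at each of the [l - k] later steps up to [r l.+1].
    [linear_recurrence_solution] proves this by induction; the read-out then distributes [Wout] over
    the sum. *)

Lemma linear_recurrence_solution (R : pzRingType) (m n : nat) (A : 'M[R]_n)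
    (B : 'M[R]_(n, m)) (x : nat -> 'cV[R]_m) (r : nat -> 'cV[R]_n) :
    r 1%N = 0 ->
    (forall i : nat, (1 <= i)%N -> r i.+1 = A *m r i + B *m x i) ->
  forall l : nat, r l.+1 = \sum_(1 <= k < l.+1) A ^+ (l - k) *m B *m x k.
Proof.
move=> r1 rS; elim=> [|l IHl]; first by rewrite big_geq.
(* The newest input is the last summand, with power [A ^+ 0]; the older ones each gain a factor
   [A]. *)
rewrite rS // IHl [RHS]big_nat_recr //= subnn expr0 mul1mx mulmx_sumr; congr (_ + _).
apply: eq_big_nat => k /andP[_ lt_kl].
(* Truncated subtraction: [k <= l] gives [l.+1 - k = (l - k).+1]. *)
by rewrite subSn // exprS -mulmxE !mulmxA.
Qed.

(* Sequences are indexed from 1; their values at index 0 are unconstrained. *)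
Theorem mainTheorem1 (R : realType) (dx dr : nat)
    (dx_ge1 : (1 <= dx)%N) (dr_ge1 : (1 <= dr)%N)
    (A : 'M[R]_dr) (Win : 'M[R]_(dr, dx)) (Wout : 'M[R]_(dx, dr))
    (x : nat -> 'cV[R]_dx) (r : nat -> 'cV[R]_dr) (y : nat -> 'cV[R]_dx)
    (r_init : r 1%N = 0)
    (r_rec : forall i : nat, (1 <= i)%N -> r i.+1 = A *m r i + Win *m x i)
    (y_readout : forall i : nat, (1 <= i)%N -> y i.+1 = Wout *m r i.+1) :
  forall l : nat, (1 <= l)%N ->
    y l.+1 = \sum_(1 <= k < l.+1) var_coef A Win Wout (l + 1 - k)%N *m x k.
Proof.
move=> l l_ge1; rewrite y_readout // (linear_recurrence_solution r_init r_rec).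
rewrite mulmx_sumr; apply: eq_big_nat => k _.
(* Swapping the two subtractions turns the exponent [l + 1 - k - 1] into [l - k]. *)
by rewrite /var_coef subnAC addnK !mulmxA.
Qed.
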